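(* Let $G$ be an abelian group, $\mathbb F$ a field, and $S\in\mathcal S(G)$. For $\gamma\in\mathrm{Hom}(\mathcal Z_S,\mathbb F^\times)$ define $\varepsilon_\gamma\colon G\times G\to\mathbb F$ by $\varepsilon_\gamma(g,h)=\gamma(\{g,h\})$ if $\{g,h\}\in S$ and $\varepsilon_\gamma(g,h)=0$ otherwise. Then $\gamma\mapsto\varepsilon_\gamma$ is an isomorphism from $\mathrm{Hom}(\mathcal Z_S,\mathbb F^\times)$ onto the group (under pointwise multiplication) of generic $G$-graded contractions with support $S$. Moreover, it induces a bijection between the group $\mathrm H^2_S(\mathbb F^\times)=\mathrm{Hom}(\mathcal Z_S,\mathbb F^\times)/\mathrm B^2_S(\mathbb F^\times)$ and the set of equivalence classes, with respect to equivalence via normalization, of generic $G$-graded contractions with support $S$.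
   Context: $G$ is written multiplicatively. $\mathcal P_G$ is the set of unordered pairs $\{g,h\}$ of elements of $G$ (with $g=h$ allowed). A generic $G$-graded contraction is a map $\varepsilon\colon G\times G\to\mathbb F$ satisfying $\varepsilon(g,h)=\varepsilon(h,g)$ and $\varepsilon(g,hk)\varepsilon(h,k)=\varepsilon(k,gh)\varepsilon(g,h)$ for all $g,h,k\in G$; by symmetry it is regarded as a function on $\mathcal P_G$. Its support is $S(\varepsilon)=\{\{g,h\}\in\mathcal P_G\mid\varepsilon(g,h)\neq0\}$. $\mathcal S(G)$ is the set of all subsets $S\subset\mathcal P_G$ such that, for all $g,h,k\in G$, $\{g,h\},\{gh,k\}\in S$ implies $\{h,k\},\{g,hk\}\in S$. For $\alpha\colon G\to\mathbb F^\times$ put $d\alpha(g,h)=\alpha(g)\alpha(h)\alpha(gh)^{-1}$. Two contractions $\varepsilon,\varepsilon'$ are equivalent via normalization if $\varepsilon'=\varepsilon\,d\alpha$ (pointwise product) for some $\alpha\colon G\to\mathbb F^\times$. $\mathcal F_G$ is the free abelian group (written multiplicatively) on $\mathcal P_G$; $\mathcal R_G\subset\mathcal F_G$ is the set of all elements $\{g,h\}\{gh,k\}\{h,k\}^{-1}\{g,hk\}^{-1}$, $g,h,k\in G$. $\mathcal F_S\subset\mathcal F_G$ is the free abelian group on $S$, $\mathcal R_S:=\mathcal R_G\cap\mathcal F_S$, and $\mathcal Z_S:=\mathcal F_S/\langle\mathcal R_S\rangle$. $\mathrm B^2_S(\mathbb F^\times)$ is the group of restrictions to $S$ of the functions $d\alpha$,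 $\alpha\colon G\to\mathbb F^\times$, viewed as a subgroup of $\mathrm{Fun}(S,\mathbb F^\times)=\mathrm{Hom}(\mathcal F_S,\mathbb F^\times)$; it lies in $\mathrm{Hom}(\mathcal Z_S,\mathbb F^\times)$. *)

(* Defs.v *)
From HB Require Import structures.
From mathcomp Require Import all_boot all_order all_algebra.
From mathcomp Require Import generic_quotient ring_quotient.
From mathcomp Require Import finmap boolp classical_sets.
From mathcomp.multinomials Require Import freeg.

Set Implicit Arguments.
Unset Strict Implicit.
Unset Printing Implicit Defensive.

Import GRing.Theory.

Local Open Scope fset_scope.
Local Open Scope classical_set_scope.
Local Open Scope ring_scope.
Local Open Scope quotient_scope.

(* Abelian groups are written multiplicatively; the library's zmodType is their
   additive counterpart, and Algebra.to_multiplicative goes from one to the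
   other. *)
HB.mixin Record Group_isAbelian G of Group G := {
  abmulC : forall x y : G, (x * y = y * x)%g
}.

#[short(type="abGroupType")]
HB.structure Definition AbGroup := {G of Group_isAbelian G & Group G}.

HB.instance Definition _ (V : zmodType) :=
  Group_isAbelian.Build (Algebra.to_multiplicative V) (@addrC V).

Section QuotientGroup.
Variables (A : abGroupType) (P : groupClosed A).

Definition coset_equiv (x y : A) := (x / y)%g \in P.

Lemma coset_equivP : equiv_class_of coset_equiv.
Proof.
split=> [x|x y|y x z]; rewrite /coset_equiv ?divgg ?gpred1 //.
  by rewrite -[in RHS]gpredV invgF.
move=> xy yz; have -> : (x / z = (x / y) * (y / z))%g by rewrite mulgA divgK.
exact: gpredM.
Qed.

Canonical coset_equiv_equiv := EquivRelPack coset_equivP.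
Canonical coset_equiv_encModRel := defaultEncModRel coset_equiv.

Definition quotGroup := {eq_quot coset_equiv}.

HB.instance Definition _ : EqQuotient A coset_equiv quotGroup :=
  EqQuotient.on quotGroup.
HB.instance Definition _ := Choice.on quotGroup.

Lemma coset_eqP (x y : A) :
  reflect (x = y %[mod quotGroup]) ((x / y)%g \in P).
Proof. by apply: (iffP idP) => [h|/eqP]; [apply/eqP|]; rewrite piE. Qed.

Definition quotGroup_one : quotGroup := lift_cst quotGroup 1%g.
Definition quotGroup_inv := lift_op1 quotGroup (fun x : A => x^-1%g).
Definition quotGroup_mul := lift_op2 quotGroup (fun x y : A => (x * y)%g).

Canonical pi_quotGroup1_morph := PiConst quotGroup_one.

Lemma pi_quotGroupV : {morph \pi : x / x^-1%g >-> quotGroup_inv x}.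
Proof.
move=> x; unlock quotGroup_inv; apply: (elimT (coset_eqP _ _)).
by rewrite invgK abmulC; apply/coset_eqP; rewrite reprK.
Qed.
Canonical pi_quotGroupV_morph := PiMorph1 pi_quotGroupV.

Lemma pi_quotGroupM : {morph \pi : x y / (x * y)%g >-> quotGroup_mul x y}.
Proof.
move=> x y; unlock quotGroup_mul; apply: (elimT (coset_eqP _ _)).
set a := repr _; set b := repr _.
have -> : (x * y / (a * b) = (x / a) * (y / b))%g.
  by rewrite invgM mulgA -(mulgA x y) -(mulgA x) (abmulC _ a^-1%g) mulgA.
by apply: gpredM; apply/coset_eqP; rewrite reprK.
Qed.
Canonical pi_quotGroupM_morph := PiMorph2 pi_quotGroupM.

Lemma quotGroup_mulA : associative quotGroup_mul.
Proof.
move=> x y z; rewrite -[x]reprK -[y]reprK -[z]reprK.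
by rewrite !piE mulgA.
Qed.
Lemma quotGroup_mulC : commutative quotGroup_mul.
Proof.
by move=> x y; rewrite -[x]reprK -[y]reprK !piE abmulC.
Qed.
Lemma quotGroup_mul1 : left_id quotGroup_one quotGroup_mul.
Proof. by move=> x; rewrite -[x]reprK !piE mul1g. Qed.
Lemma quotGroup_mul1r : right_id quotGroup_one quotGroup_mul.
Proof. by move=> x; rewrite quotGroup_mulC quotGroup_mul1. Qed.
Lemma quotGroup_mulV : left_inverse quotGroup_one quotGroup_inv quotGroup_mul.
Proof. by move=> x; rewrite -[x]reprK !piE mulVg. Qed.
Lemma quotGroup_mulVr : right_inverse quotGroup_one quotGroup_inv quotGroup_mul.
Proof. by move=> x; rewrite quotGroup_mulC quotGroup_mulV. Qed.

HB.instance Definition _ := isGroup.Build quotGroup quotGroup_mulA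
  quotGroup_mul1 quotGroup_mul1r quotGroup_mulV quotGroup_mulVr.
HB.instance Definition _ := Group_isAbelian.Build quotGroup quotGroup_mulC.

End QuotientGroup.

(* Hom(A, B) under pointwise multiplication; between groups, multiplicative
   maps automatically preserve 1 and inverses. *)
Section HomGroup.
Variables (A : groupType) (B : abGroupType).

Definition homGroup := {multiplicative A -> B}.

HB.instance Definition _ := gen_eqMixin homGroup.
HB.instance Definition _ := gen_choiceMixin homGroup.

Lemma homGroupP (f g : homGroup) : (forall x, f x = g x) -> f = g.
Proof.
move: f g => [f [[fM]]] [g [[gM]]] /= /funext fg.
by case: _ / fg in gM *; rewrite (Prop_irrelevance fM gM).
Qed.

Lemma hom_one_subproof : {morph (fun=> 1%g : B) : x y / (x * y : A)%g >-> (x * y)%g}.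
Proof. by move=> x y; rewrite mulg1. Qed.
Lemma hom_inv_subproof (f : homGroup) :
  {morph (fun x => (f x)^-1%g : B) : x y / (x * y : A)%g >-> (x * y)%g}.
Proof. by move=> x y; rewrite gmulfM invgM abmulC. Qed.
Lemma hom_mul_subproof (f g : homGroup) :
  {morph (fun x => f x * g x : B)%g : x y / (x * y : A)%g >-> (x * y)%g}.
Proof.
by move=> x y; rewrite !gmulfM !mulgA -(mulgA (f x)) (abmulC (f y)) !mulgA.
Qed.

Definition hom_one : homGroup := HB.pack (fun=> 1%g : B)
  (isMultiplicative.Build A B _ hom_one_subproof).
Definition hom_inv (f : homGroup) : homGroup := HB.pack (fun x => (f x)^-1%g : B)
  (isMultiplicative.Build A B _ (hom_inv_subproof f)).
Definition hom_mul (f g : homGroup) : homGroup := HB.pack (fun x => f x * g x : B)%g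
  (isMultiplicative.Build A B _ (hom_mul_subproof f g)).

Lemma hom_mulA : associative hom_mul.
Proof. by move=> f g h; apply: homGroupP => x /=; rewrite mulgA. Qed.
Lemma hom_mulC : commutative hom_mul.
Proof. by move=> f g; apply: homGroupP => x /=; rewrite abmulC. Qed.
Lemma hom_mul1 : left_id hom_one hom_mul.
Proof. by move=> f; apply: homGroupP => x /=; rewrite mul1g. Qed.
Lemma hom_mul1r : right_id hom_one hom_mul.
Proof. by move=> f; apply: homGroupP => x /=; rewrite mulg1. Qed.
Lemma hom_mulV : left_inverse hom_one hom_inv hom_mul.
Proof. by move=> f; apply: homGroupP => x /=; rewrite mulVg. Qed.
Lemma hom_mulVr : right_inverse hom_one hom_inv hom_mul.
Proof. by move=> f; apply: homGroupP => x /=; rewrite mulgV. Qed.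

HB.instance Definition _ := isGroup.Build homGroup hom_mulA hom_mul1 hom_mul1r
  hom_mulV hom_mulVr.
HB.instance Definition _ := Group_isAbelian.Build homGroup hom_mulC.

End HomGroup.

Section FieldUnits.
Variable F : fieldType.

Definition fieldUnits := {x : F | x != 0}.
HB.instance Definition _ := SubChoice.on fieldUnits.

Definition fu_one : fieldUnits := Sub 1 (oner_neq0 F).
Lemma fu_mul_subproof (x y : fieldUnits) : \val x * \val y != 0.
Proof. by rewrite mulf_neq0 ?(valP x) ?(valP y). Qed.
Lemma fu_inv_subproof (x : fieldUnits) : (\val x)^-1 != 0.
Proof. by rewrite invr_neq0 ?(valP x). Qed.
Definition fu_mul (x y : fieldUnits) : fieldUnits := Sub (\val x * \val y) (fu_mul_subproof x y).
Definition fu_inv (x : fieldUnits) : fieldUnits := Sub (\val x)^-1 (fu_inv_subproof x).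

Lemma fu_mulA : associative fu_mul.
Proof. by move=> x y z; apply: val_inj; rewrite /= mulrA. Qed.
Lemma fu_mulC : commutative fu_mul.
Proof. by move=> x y; apply: val_inj; rewrite /= mulrC. Qed.
Lemma fu_mul1 : left_id fu_one fu_mul.
Proof. by move=> x; apply: val_inj; rewrite /= mul1r. Qed.
Lemma fu_mul1r : right_id fu_one fu_mul.
Proof. by move=> x; apply: val_inj; rewrite /= mulr1. Qed.
Lemma fu_mulV : left_inverse fu_one fu_inv fu_mul.
Proof. by move=> x; apply: val_inj; rewrite /= mulVf ?(valP x). Qed.
Lemma fu_mulVr : right_inverse fu_one fu_inv fu_mul.
Proof. by move=> x; rewrite fu_mulC fu_mulV. Qed.

HB.instance Definition _ := isGroup.Build fieldUnits fu_mulA fu_mul1 fu_mul1r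
  fu_mulV fu_mulVr.
HB.instance Definition _ := Group_isAbelian.Build fieldUnits fu_mulC.

End FieldUnits.

(* The subgroup of V generated by A: the intersection of all the subgroups
   of V that contain A. *)
Section GeneratedSubgroup.
Variables (V : zmodType) (A : set V).

Definition gen_zmod : pred V :=
  fun x => `[< forall H : zmodClosed V, (forall a, A a -> a \in H) -> x \in H >].

Lemma gen_zmod_closed : zmod_closed gen_zmod.
Proof.
split=> [|x y /asboolP hx /asboolP hy]; apply/asboolP => H AH.
  exact: rpred0.
by rewrite rpredB ?hx ?hy.
Qed.

HB.instance Definition _ := GRing.isZmodClosed.Build V gen_zmod gen_zmod_closed.
Definition gen_subgroup : zmodClosed V := GRing.ZmodClosed.clone V gen_zmod _.

End GeneratedSubgroup.

(* The unordered pair {g, h}, with g = h allowed, is the set whose elements are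
   g and h: a set with one or two elements. *)
Definition upair (G : choiceType) := {A : {fset G} | (0 < #|` A| <= 2)%N}.

Section UPair.
Variable G : choiceType.

HB.instance Definition _ := SubChoice.on (upair G).

Lemma mkupair_subproof (g h : G) : (0 < #|` [fset g; h]| <= 2)%N.
Proof. by rewrite cardfs2; case: (g != h). Qed.

Definition mkupair (g h : G) : upair G := Sub [fset g; h] (mkupair_subproof g h).

Lemma mkupairC g h : mkupair g h = mkupair h g.
Proof. by apply: val_inj; rewrite /= fsetUC. Qed.

Lemma mkupair_inj g h x y : mkupair g h = mkupair x y ->
  (x, y) = (g, h) \/ (x, y) = (h, g).
Proof.
move=> /(congr1 val) /= e.
have := fset21 x y; have := fset22 x y; rewrite -e !inE.
have := fset21 g h; have := fset22 g h; rewrite e !inE.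
do 4!case/orP=> /eqP ?; subst; by [left|right].
Qed.

Lemma mkupair_ex (p : upair G) : exists g h, p = mkupair g h.
Proof.
set A : {fset G} := val p; have /andP[A0] := valP p.
move=> A2; suff [g [h e]] : exists g h, A = [fset g; h].
  by exists g, h; apply: val_inj.
move: A2; rewrite leq_eqVlt ltnS => /orP[/eqP A2|A1].
- have /fset0Pn[g gA] : A != fset0 by rewrite -cardfs_gt0.
  have : #|` (A `\ g)%fset| = 1%N by rewrite (cardfsD1 g A) gA in A2; case: A2.
  move=> /eqP/cardfs1P[h e]; exists g, h.
  by rewrite -e fsetD1K.
- have /eqP/cardfs1P[g e] : #|` A| = 1%N by apply/eqP; rewrite eqn_leq A1.
  by exists g, g; rewrite e fsetUid.
Qed.

End UPair.

Section Support.
Variable G : abGroupType.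

Definition calS : set (set (upair G)) := [set S | forall g h k : G,
  S (mkupair g h) -> S (mkupair (g * h)%g k) ->
  S (mkupair h k) /\ S (mkupair g (h * k)%g)].

(* The free abelian group on the unordered pairs, here written additively:
   << p >> is the generator p. *)
Definition FG := {freeg (upair G) / int}.
HB.instance Definition _ := GRing.Zmodule.on FG.

Definition RG : set FG := [set r | exists g h k : G,
  r = << mkupair g h >> + << mkupair (g * h)%g k >>
      - << mkupair h k >> - << mkupair g (h * k)%g >>].

Section OnSupport.
Variable S : set (upair G).

(* The subgroup F_S: the elements of F_G in which only generators from S occur. *)
Definition FS_pred : pred FG := fun D => all (fun p => p \in S) (dom D).

Lemma FS_closed : zmod_closed FS_pred.
Proof.
split=> [|x y /allP hx /allP hy]; rewrite /in_mem /= /FS_pred ?dom0 //.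
by apply/allP => p /domB; rewrite mem_cat => /orP[/hx|/hy].
Qed.

HB.instance Definition _ := GRing.isZmodClosed.Build FG FS_pred FS_closed.

Definition FS := {D : FG | FS_pred D}.
HB.instance Definition _ := SubChoice.on FS.
HB.instance Definition _ := [SubChoice_isSubZmodule of FS by <:].

(* The intersection of R_G and F_S, as a subset of F_S. *)
Definition RS : set FS := [set r | RG (\val r)].

(* Z_S as a multiplicative group, obtained from the additive group quotient. *)
Definition ZS := Algebra.to_multiplicative {ideal_quot (gen_subgroup RS)}.
HB.instance Definition _ := AbGroup.on ZS.

Lemma FSgen_subproof (p : S) : FS_pred << \val p >>.
Proof. by rewrite /FS_pred domU1 /= (valP p). Qed.

(* The image in Z_S of the free generator p, for p in S. *)
Definition ZSgen (p : S) : ZS :=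
  \pi_{ideal_quot (gen_subgroup RS)} (Sub << \val p >> (FSgen_subproof p) : FS).

End OnSupport.
End Support.

Arguments calS : clear implicits.
Arguments RG : clear implicits.

Section Contractions.
Variables (G : abGroupType) (F : fieldType).
Local Notation Fx := (fieldUnits F).

Definition is_contraction (eps : G -> G -> F) : Prop :=
  (forall g h, eps g h = eps h g) /\
  (forall g h k, eps g (h * k)%g * eps h k = eps k (g * h)%g * eps g h).

Definition supp (eps : G -> G -> F) : set (upair G) :=
  [set p | exists g h, p = mkupair g h /\ eps g h != 0].

Definition dcobound (alpha : G -> Fx) (g h : G) : Fx :=
  (alpha g * alpha h * (alpha (g * h))^-1)%g.

Definition norm_equiv (eps eps' : G -> G -> F) : Prop :=
  exists alpha : G -> Fx, forall g h, eps' g h = eps g h * \val (dcobound alpha g h).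

Lemma dcobound1 : dcobound (fun=> 1%g) = fun _ _ => 1%g.
Proof. by apply/funext => g; apply/funext => h; rewrite /dcobound !mul1g invg1. Qed.

Lemma dcoboundM a b g h :
  dcobound (fun x => a x * b x)%g g h = (dcobound a g h * dcobound b g h)%g.
Proof.
by apply: val_inj; rewrite /dcobound /= invfM (mulrACA (sval (a g))) [LHS]mulrACA.
Qed.

Lemma dcoboundV a g h : dcobound (fun x => (a x)^-1)%g g h = (dcobound a g h)^-1%g.
Proof. by apply: val_inj; rewrite /dcobound /= !invfM. Qed.

Lemma mem_supp eps g h : (forall x y, eps x y = eps y x) ->
  supp eps (mkupair g h) <-> eps g h != 0.
Proof.
move=> epsC; split=> [[x [y [/mkupair_inj[] [-> ->] //]]]|ne0].
  by rewrite epsC.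
by exists g, h.
Qed.

Section OnSupport.
(* S is an element of the subtype {S : set (upair G) | S \in calS G}; the set of
   pairs itself is \val S. *)
Variable S : calS G.

Definition contraction_on_pred (eps : G -> G -> F) : bool :=
  `[< is_contraction eps /\ supp eps = \val S >].

Definition contraction_on := {eps : G -> G -> F | contraction_on_pred eps}.
HB.instance Definition _ := SubChoice.on contraction_on.

Lemma contraction_onP (x y : contraction_on) :
  (forall g h, \val x g h = \val y g h) -> x = y.
Proof.
by move=> xy; apply: val_inj; apply/funext => g; apply/funext => h.
Qed.

(* Contractions with support S form a group under pointwise multiplication: the
   neutral element is the indicator function of S and, as 0^-1 = 0, the inverse
   is the pointwise one. *)
Lemma con_one_subproof :
  contraction_on_pred (fun g h => if mkupair g h \in \val S then 1 else 0).
Proof.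
have SS := set_mem (valP S).
apply/asboolP; split; [split|].
- by move=> g h; rewrite mkupairC.
- move=> g h k.
  have [|] := boolP (mkupair g h \in \val S); last first.
    rewrite mulr0; have [/set_mem hk nS|_ _] := boolP (mkupair h k \in _).
      case: (boolP (mkupair g (h * k)%g \in _)); last by rewrite mul0r.
      rewrite mkupairC abmulC => /set_mem ghk.
      move: hk; rewrite mkupairC => hk; have [] := SS _ _ _ hk ghk.
      by rewrite mkupairC => /mem_set; rewrite (negPf nS).
    by rewrite mulr0.
  rewrite mulr1 => /set_mem gh.
  have [/set_mem|nS] := boolP (mkupair k (g * h)%g \in _).
    by rewrite mkupairC => ghk; have [/mem_set-> /mem_set->] := SS _ _ _ gh ghk;
      rewrite mulr1.
  have [/set_mem hk|_] := boolP (mkupair h k \in _); last by rewrite mulr0.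
  have [/set_mem|_] := boolP (mkupair g (h * k)%g \in _); last by rewrite mul0r.
  rewrite mkupairC abmulC => ghk; move: hk; rewrite mkupairC => hk.
  have [_ /mem_set] := SS _ _ _ hk ghk.
  by rewrite (abmulC h) (negPf nS).
- apply/seteqP; split=> [p [g [h [-> ]]]|p Sp].
    by case: ifP => [/set_mem//|]; rewrite eqxx.
  have [g [h e]] := mkupair_ex p; exists g, h; split=> //.
  by rewrite -e mem_set ?oner_neq0.
Qed.

Lemma con_mul_subproof (x y : contraction_on) :
  contraction_on_pred (fun g h => \val x g h * \val y g h).
Proof.
have /asboolP[[xC xA] xS] := valP x; have /asboolP[[yC yA] yS] := valP y.
apply/asboolP; split; [split|].
- by move=> g h; rewrite xC yC.
- by move=> g h k; rewrite mulrACA xA yA mulrACA.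
- apply/seteqP; split=> [p [g [h [-> ]]]|p Sp].
    by rewrite mulf_eq0 negb_or => /andP[nx _]; rewrite -xS; exists g, h.
  have [g [h e]] := mkupair_ex p; exists g, h; split=> //.
  have := Sp; rewrite -{1}xS e => /(mem_supp _ _ xC) nx.
  have := Sp; rewrite -{1}yS e => /(mem_supp _ _ yC) ny.
  by rewrite mulf_neq0.
Qed.

Lemma con_inv_subproof (x : contraction_on) :
  contraction_on_pred (fun g h => (\val x g h)^-1).
Proof.
have /asboolP[[xC xA] xS] := valP x.
apply/asboolP; split; [split|].
- by move=> g h; rewrite xC.
- by move=> g h k; rewrite -!invfM xA.
- rewrite -[RHS]xS; apply/seteqP; split=> p [g [h [-> nx]]]; exists g, h;
    by split=> //; move: nx; rewrite invr_eq0.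
Qed.

Definition con_one : contraction_on := exist contraction_on_pred _ con_one_subproof.
Definition con_mul (x y : contraction_on) : contraction_on :=
  exist contraction_on_pred _ (con_mul_subproof x y).
Definition con_inv (x : contraction_on) : contraction_on :=
  exist contraction_on_pred _ (con_inv_subproof x).

Lemma con_mulA : associative con_mul.
Proof. by move=> x y z; apply: contraction_onP => g h; rewrite /= mulrA. Qed.
Lemma con_mulC : commutative con_mul.
Proof. by move=> x y; apply: contraction_onP => g h; rewrite /= mulrC. Qed.

Lemma con_neq0 (x : contraction_on) g h :
  mkupair g h \in \val S = (\val x g h != 0).
Proof.
have /asboolP[[xC _] xS] := valP x; rewrite -xS.
by apply/idP/idP => [/set_mem/(mem_supp _ _ xC)|nx] //; apply/mem_set; exists g, h.
Qed.

Lemma con_mul1 : left_id con_one con_mul.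
Proof.
move=> x; apply: contraction_onP => g h /=.
by rewrite (con_neq0 x); case: eqP => [->|]; rewrite ?mulr0 ?mul1r.
Qed.
Lemma con_mul1r : right_id con_one con_mul.
Proof. by move=> x; rewrite con_mulC con_mul1. Qed.
Lemma con_mulV : left_inverse con_one con_inv con_mul.
Proof.
move=> x; apply: contraction_onP => g h /=.
by rewrite (con_neq0 x); case: eqP => [->|/eqP nx]; rewrite ?mulr0 ?mulVf.
Qed.
Lemma con_mulVr : right_inverse con_one con_inv con_mul.
Proof. by move=> x; rewrite con_mulC con_mulV. Qed.

HB.instance Definition _ := isGroup.Build contraction_on con_mulA con_mul1
  con_mul1r con_mulV con_mulVr.
HB.instance Definition _ := Group_isAbelian.Build contraction_on con_mulC.

Definition norm_equivb (x y : contraction_on) := `[< norm_equiv (\val x) (\val y) >].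

Lemma norm_equivP : equiv_class_of norm_equivb.
Proof.
have sym x y : norm_equivb x y -> norm_equivb y x.
  move=> /asboolP[a xy]; apply/asboolP; exists (fun g => (a g)^-1%g) => g h.
  by rewrite xy dcoboundV /= mulfK ?(valP (dcobound a g h)).
split=> [x|x y|y x z].
- apply/asboolP; exists (fun=> 1%g) => g h.
  by rewrite dcobound1 /= mulr1.
- by apply/idP/idP; apply: sym.
- move=> /asboolP[a xy] /asboolP[b yz]; apply/asboolP.
  exists (fun g => a g * b g)%g => g h.
  by rewrite yz xy dcoboundM -mulrA.
Qed.

Canonical norm_equivb_equiv := EquivRelPack norm_equivP.
Canonical norm_equivb_encModRel := defaultEncModRel norm_equivb.

(* A contraction equivalent to one with support S has itself support S, so these
   are full equivalence classes. *)
Definition norm_classes := {eq_quot norm_equivb}.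
HB.instance Definition _ : EqQuotient contraction_on norm_equivb norm_classes :=
  EqQuotient.on norm_classes.
HB.instance Definition _ := Choice.on norm_classes.

Definition HomZS := homGroup (ZS (\val S)) Fx.
HB.instance Definition _ := AbGroup.on HomZS.

(* B^2_S inside Fun(S, F^x): the restrictions to S of the functions d(alpha),
   which depend only on the unordered pair. *)
Definition B2fun : set (\val S -> Fx) :=
  [set f | exists alpha : G -> Fx, forall (p : \val S) g h,
    \val p = mkupair g h -> f p = dcobound alpha g h].

(* B^2_S inside Hom(Z_S, F^x); a homomorphism is determined by, and identified
   with, the function it induces on the generators. *)
Definition B2 : pred HomZS := fun gamma => `[< B2fun (fun p => gamma (ZSgen p)) >].

Lemma B2_closed : group_closed B2.
Proof.
split=> [|x y /asboolP[a xa] /asboolP[b yb]]; apply/asboolP.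
  by exists (fun=> 1%g) => p g h _; rewrite dcobound1.
exists (fun g => a g * (b g)^-1)%g => p g h e.
rewrite dcoboundM dcoboundV -(xa _ _ _ e) -(yb _ _ _ e) //.
Qed.

HB.instance Definition _ :=
  isMulClosed.Build HomZS B2 (group_closedM B2_closed).
HB.instance Definition _ := isMul1Closed.Build HomZS B2 B2_closed.1.
HB.instance Definition _ :=
  isInvClosed.Build HomZS B2 (group_closedV B2_closed).
Definition B2_subgroup : groupClosed HomZS := GroupClosed.clone HomZS B2 _.

Definition H2 := quotGroup B2_subgroup.
HB.instance Definition _ := AbGroup.on H2.

(* insub p is Some p when p belongs to S, and None otherwise. *)
Definition eps_of (gamma : HomZS) (g h : G) : F :=
  if insub (mkupair g h) is Some p then \val (gamma (ZSgen p)) else 0.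

End OnSupport.

End Contractions.

(* Main.v *)
Require Import Defs.
From HB Require Import structures.
From mathcomp Require Import all_boot all_algebra.
From mathcomp Require Import generic_quotient ring_quotient.
From mathcomp Require Import boolp classical_sets.
From mathcomp.multinomials Require Import freeg.

(* A contraction with support S is a nonvanishing function on S satisfying the
   relations [{g,h}{gh,k} = {h,k}{g,hk}] whose four pairs all lie in S; for all
   other triples both sides of the contraction identity vanish, because S is in
   [calS G].  The only discrepancy with [Z_S] is that an element of [R_G] may fall
   into [F_S] through cancellation of pairs outside S.  What then remains is
   [{u,1}{v,1}^-1], and this already follows from the relations inside S: the
   triple [(u,1,1)] identifies [{u,1}] with [{1,1}]. *)

Set Implicit Arguments.
Unset Strict Implicit.
Unset Printing Implicit Defensive.

Local Open Scope quotient_scope.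
Local Open Scope ring_scope.

Import GRing.Theory.

(** * Generalities on unordered pairs, generated subgroups and homomorphisms *)

Lemma inj_surj_bijective (A B : Type) (f : A -> B) :
  injective f -> (forall y, exists x, f x = y) -> bijective f.
Proof.
by move=> f_inj /choice[g fgK]; exists g => // x; apply: f_inj; rewrite fgK.
Qed.

(** A pair determines its entries up to a swap, which [eC] absorbs. This turns a contraction into a
    function on pairs. *)
Lemma upair_lift (K : choiceType) (T : Type) (e : K -> K -> T) :
  (forall g h, e g h = e h g) ->
  exists f : upair K -> T, forall g h, f (mkupair g h) = e g h.
Proof.
move=> eC.
suff /choice[f fE] (p : upair K) :
    exists t, forall g h, p = mkupair g h -> t = e g h.
  by exists f => g h; apply: fE.
have [g [h ->]] := mkupair_ex p.
by exists (e g h) => x y /mkupair_inj[] [-> ->].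
Qed.

(** The universal map [fglift] of a free abelian group takes values in a module over the integers,
    so a multiplicative target has to be read additively. *)
Definition to_additive (B : abGroupType) : Type := B.
HB.instance Definition _ (B : abGroupType) := Choice.on (to_additive B).
HB.instance Definition _ (B : abGroupType) :=
  GRing.isZmodule.Build (to_additive B) (@mulgA B) (@abmulC B) (@mul1g B)
    (@mulVg B).

(** The kernel of [f] is one of the subgroups whose intersection is [gen_subgroup A]. *)
Lemma gen_subgroup_ker (V W : zmodType) (A : set V) (f : {additive V -> W}) :
  (forall a, A a -> f a = 0) -> forall x, x \in gen_subgroup A -> f x = 0.
Proof.
move=> fA x /asboolP Ax.
pose K : pred V := fun y => f y == 0.
have KP : zmod_closed K.
  split=> [|y z]; rewrite !unfold_in /K ?raddf0 // => /eqP y0 /eqP z0.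
  by rewrite raddfB y0 z0 subr0.
pose KZ : zmodClosed V := HB.pack K (GRing.isZmodClosed.Build _ K KP).
by apply/eqP/(Ax KZ) => a /fA/eqP.
Qed.

Lemma multiplicative1 (A B : groupType) (f : {multiplicative A -> B}) :
  f 1%g = 1%g.
Proof. by apply: (mulgI (f 1%g)); rewrite -gmulfM !mulg1. Qed.

Lemma multiplicativeF (A B : groupType) (f : {multiplicative A -> B}) :
  {morph f : x y / (x / y)%g >-> (x / y)%g}.
Proof. by move=> x y; apply: (mulIg (f y)); rewrite -gmulfM !divgK. Qed.

(** * Generators and relations of [ZS] *)

Section Presentation.
Variables (G : abGroupType) (S : set (upair G)).

Definition FSgen (p : S) : FS S := exist _ << \val p >> (FSgen_subproof p).

Definition FSval : {additive FS S -> FG G} := \val.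

(** By [freeg_sumE], [D] is a sum of integer multiples of generators over [dom D]. Since [H] lives
    in [FS S], the partial sums are rebuilt there and compared with those in [FG G] through
    [FSval]. *)
Lemma FS_gen_ind (H : zmodClosed (FS S)) :
  (forall p, FSgen p \in H) -> forall D : FS S, D \in H.
Proof.
move=> Hgen [D DS].
suff HD (s : seq (upair G)) (c : upair G -> int) : all (fun p => p \in S) s ->
    exists2 E : FS S, E \in H & FSval E = \sum_(p <- s) << c p *g p >>.
  have [E EH ED] := HD _ (fun p => coeff p D) DS.
  suff -> : exist _ D DS = E by [].
  by apply: val_inj; rewrite [RHS]ED /= freeg_sumE.
elim: s => [_|p s IHs /andP[pS /IHs[E EH ED]]].
  by exists 0; rewrite ?rpred0 // big_nil raddf0.
exists (FSgen (exist _ p pS) *~ c p + E).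
  by rewrite rpredD ?rpredMz.
by rewrite raddfD raddfMz big_cons ED [FSval _]/= freegU_mulz intz.
Qed.

Definition ZSpi (D : FS S) : ZS S := \pi_{ideal_quot (gen_subgroup (@RS G S))} D.

Lemma ZSpi0 : ZSpi 0 = 1%g.
Proof. exact: (raddf0 \pi_{ideal_quot (gen_subgroup (@RS G S))}). Qed.

Lemma ZSpiB : {morph ZSpi : x y / x - y >-> (x / y)%g}.
Proof. exact: (raddfB \pi_{ideal_quot (gen_subgroup (@RS G S))}). Qed.

Lemma ZSpiD : {morph ZSpi : x y / x + y >-> (x * y)%g}.
Proof. exact: (raddfD \pi_{ideal_quot (gen_subgroup (@RS G S))}). Qed.

Lemma ZSpi_eq D1 D2 : ZSpi D1 = ZSpi D2 <-> D1 - D2 \in gen_subgroup (@RS G S).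
Proof. by rewrite Quotient.idealrBE; split=> [/eqP|/eqP]. Qed.

Lemma ZSpi_repr (x : ZS S) :
  ZSpi (repr (x : {ideal_quot (gen_subgroup (@RS G S))})) = x.
Proof. exact: reprK. Qed.

(** The elements of [FS S] on whose classes [phi] and [psi] agree form a subgroup containing the
    generators. *)
Lemma ZS_hom_ext (B : abGroupType) (phi psi : {multiplicative ZS S -> B}) :
  (forall p, phi (ZSgen p) = psi (ZSgen p)) -> phi =1 psi.
Proof.
move=> phi_psi.
pose E : pred (FS S) := fun D => phi (ZSpi D) == psi (ZSpi D).
have EP : zmod_closed E.
  split=> [|x y]; rewrite !unfold_in /E; first by rewrite ZSpi0 !multiplicative1.
  by move=> /eqP xE /eqP yE; rewrite ZSpiB !multiplicativeF xE yE.
pose EZ : zmodClosed (FS S) := HB.pack E (GRing.isZmodClosed.Build _ E EP).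
move=> x; rewrite -[x]ZSpi_repr; apply/eqP/(@FS_gen_ind EZ) => p.
exact/eqP/phi_psi.
Qed.

Lemma ZSgen_relation g h k (p q r s : S) :
  \val p = mkupair g h -> \val q = mkupair (g * h)%g k ->
  \val r = mkupair h k -> \val s = mkupair g (h * k)%g ->
  (ZSgen p * ZSgen q = ZSgen r * ZSgen s)%g.
Proof.
move=> pE qE rE sE.
rewrite -[LHS]/(ZSpi (FSgen p) * ZSpi (FSgen q))%g.
rewrite -[RHS]/(ZSpi (FSgen r) * ZSpi (FSgen s))%g -!ZSpiD.
apply/ZSpi_eq/asboolP => H; apply; exists g, h, k.
by rewrite -[LHS]/(FSval _) raddfB !raddfD /= pE qE rE sE addrA.
Qed.

(** * Homomorphisms out of [ZS] *)

Section Lift.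
Variables (B : abGroupType) (f : upair G -> B).
Hypothesis fS : forall g h k, S (mkupair g h) -> S (mkupair (g * h)%g k) ->
  (f (mkupair g h) * f (mkupair (g * h) k)
   = f (mkupair h k) * f (mkupair g (h * k)))%g.

Let f_add : upair G -> zmodule (to_additive B) := f.
Let lift : {additive FG G -> zmodule (to_additive B)} :=
  HB.pack (fglift f_add)
    (GRing.isZmodMorphism.Build _ _ (fglift f_add) (lift_is_additive f_add)).

Let lift_gen p : lift << p >> = f p.
Proof. by rewrite [LHS]liftU scale1r. Qed.

(** If the two generators differ, nothing cancels and both pairs lie in [S]. The relation for the
    triple (w,1,1) then makes [f] take the value of {1,1} on both. *)
Let lift_star u v : FS_pred S (<< mkupair u 1%g >> - << mkupair v 1%g >>) ->
  lift (<< mkupair u 1%g >> - << mkupair v 1%g >>) = 0.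
Proof.
have [-> _|uv] := eqVneq (mkupair u 1%g) (mkupair v 1%g).
  by rewrite subrr raddf0.
move=> /allP Suv.
have Su : S (mkupair u 1%g).
  apply/set_mem/Suv; rewrite mem_dom coeffB !coeffU eqxx (eq_sym (mkupair v _)).
  by rewrite (negPf uv).
have Sv : S (mkupair v 1%g).
  apply/set_mem/Suv; rewrite mem_dom coeffB !coeffU eqxx.
  by rewrite (negPf uv).
have f1 w : S (mkupair w 1%g) -> f (mkupair w 1%g) = f (mkupair 1%g 1%g).
  move=> Sw; have := @fS w 1%g 1%g Sw; rewrite !mulg1 => /(_ Sw).
  exact: mulIg.
by rewrite raddfB !lift_gen !f1 ?subrr.
Qed.

(** If {g,h} and {gh,k} lie in [S], this is [fS]. Otherwise a pair outside [S] cancels, which forces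
    g = k or one of g, h, k to be 1. *)
Let lift_relation (r : FG G) : RG G r -> FS_pred S r -> lift r = 0.
Proof.
move=> [g [h [k]]].
set a := mkupair g h; set b := mkupair _ k; set c := mkupair h k.
set d := mkupair g _ => rE rS.
have Sr x : coeff x r != 0 -> S x.
  by move/allP: rS => rS rx; apply/set_mem/rS; rewrite mem_dom.
(* Degenerate triples: for g = k everything cancels by commutativity; if g, h or k is 1, two terms
   cancel and the other two are pairs with entry 1, as in [lift_star]. *)
have gk0 : g = k -> lift r = 0.
  move=> gk; rewrite rE /a /b /c /d -gk (mkupairC h) (mkupairC (g * h)%g) (abmulC h).
  by rewrite addrAC addrK subrr raddf0.
have g1 : g = 1%g -> lift r = 0.
  move=> g1.
  have rE' : r = << mkupair h 1%g >> - << mkupair (h * k)%g 1%g >>.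
    by rewrite rE /a /b /c /d g1 mul1g addrK !(mkupairC 1%g).
  by rewrite rE'; apply: lift_star; rewrite -rE'.
have h1 : h = 1%g -> lift r = 0.
  move=> h1.
  have rE' : r = << mkupair g 1%g >> - << mkupair k 1%g >>.
    by rewrite rE /a /b /c /d h1 mul1g mulg1 (addrAC _ (- _)) addrK (mkupairC 1%g).
  by rewrite rE'; apply: lift_star; rewrite -rE'.
have k1 : k = 1%g -> lift r = 0.
  move=> k1.
  have rE' : r = << mkupair (g * h)%g 1%g >> - << mkupair h 1%g >>.
    rewrite rE /a /b /c /d k1 mulg1 (addrC << mkupair g h >>) (addrAC _ (- _)).
    by rewrite addrK.
  by rewrite rE'; apply: lift_star; rewrite -rE'.
have mulg_id (x y : G) : x = (x * y)%g -> y = 1%g.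
  by rewrite -{1}[x]mulg1 => /mulgI.
have coeffE x : coeff x r = (a == x)%:R + (b == x)%:R - (c == x)%:R - (d == x)%:R.
  by rewrite rE !coeffB coeffD !coeffU !mul1r.
(* Cancelling {g,h} against {h,k} gives g = k, and against {g,hk} gives k = 1. *)
have [Sa|nSa] := pselect (S a); last first.
  have [ca|ca] := eqVneq c a.
    by apply: gk0; move/mkupair_inj: ca => [[-> ->]|[->]].
  have [da|da] := eqVneq d a.
    by have /mkupair_inj[[]|[->]] := esym da => /esym/mulg_id.
  (* Without cancellation the coefficient of [a] is 1, or 2 when [b] equals [a]; the argument for
     [b] below is the same. *)
  case: nSa; apply: Sr; rewrite coeffE (negPf ca) (negPf da) eqxx.
  by case: (b == a).
(* Cancelling {gh,k} against {h,k} gives g = 1, and against {g,hk} gives h = 1 or g = k. *)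
have [Sb|nSb] := pselect (S b); last first.
  have [cb|cb] := eqVneq c b.
    by move/mkupair_inj: cb => [[]|[<-]]; rewrite abmulC => /esym/mulg_id.
  have [db|db] := eqVneq d b.
    by move/mkupair_inj: db => [[/esym/mulg_id + _]|[_ /esym]].
  case: nSb; apply: Sr; rewrite coeffE (negPf cb) (negPf db) eqxx.
  by case: (a == b).
rewrite rE !raddfB raddfD !lift_gen.
rewrite -addrA -opprD; apply/eqP; rewrite subr_eq0; apply/eqP; exact: fS.
Qed.

(** Universal property of [ZS]: by [lift_relation] the additive extension of [f] kills [RS], so its
    value on a class does not depend on the representative. *)
Lemma ZS_lift : exists phi : {multiplicative ZS S -> B},
  forall p : S, phi (ZSgen p) = f (\val p).
Proof.
pose phi0 (x : ZS S) : B :=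
  lift (FSval (repr (x : {ideal_quot (gen_subgroup (@RS G S))}))).
have phi0E D : phi0 (ZSpi D) = lift (FSval D).
  apply: (@subr0_eq (zmodule (to_additive B))); rewrite -!raddfB.
  apply: (gen_subgroup_ker (f := lift \o FSval)) => [r rR|].
    exact: lift_relation rR (valP r).
  by apply/ZSpi_eq; rewrite ZSpi_repr.
have phi0M : {morph phi0 : x y / (x * y)%g >-> (x * y)%g}.
  move=> x y; rewrite -[x]ZSpi_repr -[y]ZSpi_repr -ZSpiD !phi0E.
  by rewrite !raddfD.
pose phi : {multiplicative ZS S -> B} :=
  HB.pack phi0 (isMultiplicative.Build _ _ phi0 phi0M).
by exists phi => p; rewrite -[LHS]/(phi0 (ZSpi (FSgen p))) phi0E [LHS]lift_gen.
Qed.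

End Lift.
End Presentation.

(** * Contractions with support [S] as homomorphisms from [ZS] *)

Lemma val_fieldUnitsM (F : fieldType) (x y : fieldUnits F) :
  \val (x * y)%g = \val x * \val y.
Proof. by []. Qed.

Section Contractions.
Variables (G : abGroupType) (F : fieldType) (S : calS G).

Lemma calS_closed : calS G (\val S).
Proof. exact: set_mem (valP S). Qed.

Lemma eps_of_gen (gamma : HomZS F S) (p : \val S) g h :
  \val p = mkupair g h -> eps_of gamma g h = \val (gamma (ZSgen p)).
Proof. by move=> pE; rewrite /eps_of -pE valK. Qed.

Lemma eps_of_notin (gamma : HomZS F S) g h :
  ~ (\val S) (mkupair g h) -> eps_of gamma g h = 0.
Proof. by move=> nS; rewrite /eps_of insubF //; apply/negP => /set_mem. Qed.

Lemma eps_of_neq0 (gamma : HomZS F S) g h :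
  (eps_of gamma g h != 0) <-> (\val S) (mkupair g h).
Proof.
have [Sgh|nS] := pselect ((\val S) (mkupair g h)); last first.
  by rewrite eps_of_notin // eqxx; split.
rewrite (@eps_of_gen _ (SigSub (mem_set Sgh))) //.
by split=> // _; exact: (valP (gamma _)).
Qed.

Lemma eps_of_contraction (gamma : HomZS F S) :
  contraction_on_pred S (eps_of gamma).
Proof.
apply/asboolP; split; last first.
  apply/seteqP; split=> [p [g [h [-> /eps_of_neq0]]] //|p].
  by have [g [h ->]] := mkupair_ex p => Sgh; exists g, h; split=> //;
    apply/eps_of_neq0.
have eC g h : eps_of gamma g h = eps_of gamma h g by rewrite /eps_of mkupairC.
split=> // g h k; rewrite [in RHS]eC mulrC [RHS]mulrC.
(* Either all four pairs lie in [S] and the relation in [ZS] applies, or both products vanish. *)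
have [Sgh|nS] := pselect ((\val S) (mkupair g h) /\ (\val S) (mkupair (g * h)%g k)).
  have [Sp Sq] := Sgh; have [Sr Ss] := calS_closed Sp Sq.
  pose p := SigSub (mem_set Sp); pose q := SigSub (mem_set Sq).
  pose r := SigSub (mem_set Sr); pose s := SigSub (mem_set Ss).
  rewrite (@eps_of_gen _ r) // (@eps_of_gen _ s) // (@eps_of_gen _ p) //.
  rewrite (@eps_of_gen _ q) // -!val_fieldUnitsM -!gmulfM.
  by rewrite (@ZSgen_relation _ _ g h k p q r s).
have -> : eps_of gamma g h * eps_of gamma (g * h)%g k = 0.
  apply/eqP; apply: contra_notT nS.
  by rewrite mulf_eq0 negb_or => /andP[/eps_of_neq0 Sp /eps_of_neq0 Sq]; split.
(* If the product for {h,k} and {g,hk} were nonzero, closure of [S] for the reversed triple (k,h,g)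
   would put {g,h} and {gh,k} into [S]. *)
apply/eqP; apply: contra_notT nS.
rewrite mulf_eq0 negb_or => /andP[/eps_of_neq0 + /eps_of_neq0].
rewrite mkupairC (mkupairC g) (abmulC h) => Skh Skhg.
have [] := calS_closed Skh Skhg.
by rewrite mkupairC (mkupairC k) (abmulC h).
Qed.

Definition con_of (gamma : HomZS F S) : contraction_on F S :=
  exist (contraction_on_pred S) _ (eps_of_contraction gamma).

Lemma con_ofM : {morph con_of : x y / (x * y)%g >-> (x * y)%g}.
Proof.
move=> x y; apply: contraction_onP => g h.
rewrite -[LHS]/(eps_of _ g h) -[RHS]/(eps_of x g h * eps_of y g h).
have [Sgh|nS] := pselect ((\val S) (mkupair g h)); last first.
  by rewrite !eps_of_notin ?mulr0.
by rewrite !(@eps_of_gen _ (SigSub (mem_set Sgh))).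
Qed.

Lemma con_of_gen (gamma : HomZS F S) (p : \val S) g h :
  \val p = mkupair g h -> \val (con_of gamma) g h = \val (gamma (ZSgen p)).
Proof. exact: eps_of_gen. Qed.

Lemma con_of_inj : injective con_of.
Proof.
move=> x y xy; apply/homGroupP/ZS_hom_ext => p.
have [g [h pE]] := mkupair_ex (\val p).
by apply: val_inj; rewrite /= -!(con_of_gen _ pE) xy.
Qed.

(** On [S] the contraction [x] is invertible, and its contraction identity is the hypothesis of
    [ZS_lift]. *)
Lemma con_of_surj (x : contraction_on F S) : exists gamma, con_of gamma = x.
Proof.
have /asboolP[[xC xA] _] := valP x.
(* Where [x] vanishes, [f] gets the default value 1. This is harmless, since the relations to be
   checked have all four pairs in [S] by [calS_closed]. *)
have [f fE] : exists f : upair G -> fieldUnits F,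
    forall g h, f (mkupair g h) = insubd (fu_one F) (\val x g h).
  by apply: upair_lift => g h; rewrite xC.
have fS g h : (\val S) (mkupair g h) -> \val (f (mkupair g h)) = \val x g h.
  by move=> Sgh; rewrite fE insubdK // unfold_in -con_neq0 mem_set.
have [|gamma gammaE] := @ZS_lift G (\val S) (fieldUnits F) f.
  move=> g h k Sp Sq; have [Sr Ss] := calS_closed Sp Sq.
  apply: val_inj; rewrite !val_fieldUnitsM.
  by rewrite !fS // mulrC (xC _ k) -xA mulrC.
exists gamma; apply: contraction_onP => g h.
have [Sgh|nS] := pselect ((\val S) (mkupair g h)).
  by rewrite (@con_of_gen _ (SigSub (mem_set Sgh))) // gammaE fS.
have := con_neq0 x g h; rewrite memNset // => /esym/negbFE/eqP ->.
exact: eps_of_notin.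
Qed.

(** The same [a] serves in both directions: on [S] one divides by the nonzero value of [x], and off
    [S] both contractions vanish. *)
Lemma con_of_norm_equiv (x y : HomZS F S) :
  norm_equivb (con_of x) (con_of y) <-> (y / x)%g \in B2_subgroup F S.
Proof.
split=> /asboolP[a aE]; apply/asboolP; exists a.
  move=> p g h pE; apply: val_inj; have := aE g h.
  rewrite !(con_of_gen _ pE) /= => ->.
  by rewrite mulrAC mulfV ?mul1r //; exact: (valP (x _)).
move=> g h.
have [Sgh|nS] := pselect ((\val S) (mkupair g h)); last first.
  by rewrite -[LHS]/(eps_of y g h) (_ : \val _ g h = eps_of x g h) // !eps_of_notin ?mul0r.
have pE : \val (SigSub (mem_set Sgh) : \val S) = mkupair g h by [].
rewrite !(con_of_gen _ pE) -(aE _ _ _ pE) /=.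
by rewrite mulrC divfK //; exact: (valP (x _)).
Qed.

End Contractions.

(** * The isomorphism and the passage to normalization classes *)

Theorem mainTheorem1 (G : abGroupType) (F : fieldType) (S : calS G) :
  exists Phi : {multiplicative HomZS F S -> contraction_on F S},
    [/\ forall (gamma : HomZS F S) (g h : G),
          \val (Phi gamma) g h = eps_of gamma g h,
        bijective Phi
      & exists Psi : H2 F S -> norm_classes F S,
          bijective Psi /\
          forall gamma : HomZS F S,
            Psi (\pi_(H2 F S) gamma) = \pi_(norm_classes F S) (Phi gamma)].
Proof.
pose Phi : {multiplicative HomZS F S -> contraction_on F S} :=
  HB.pack (@con_of G F S) (isMultiplicative.Build _ _ _ (@con_ofM G F S)).
exists Phi; split=> //.
  exact: inj_surj_bijective (@con_of_inj G F S) (@con_of_surj G F S).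
(* Left to right, this makes the induced map independent of representatives; right to left, it makes
   it injective. *)
have pi_eq (x y : HomZS F S) :
    \pi_(H2 F S) x = \pi_(H2 F S) y
    <-> \pi_(norm_classes F S) (con_of x) = \pi_(norm_classes F S) (con_of y).
  split=> [/esym/coset_eqP/con_of_norm_equiv xy|xy].
    by apply/eqP; rewrite piE.
  by apply/esym/coset_eqP/con_of_norm_equiv; move/eqP: xy; rewrite piE.
exists (fun q => \pi_(norm_classes F S) (con_of (repr q))); split; last first.
  by move=> gamma; apply/pi_eq; rewrite reprK.
apply: inj_surj_bijective => [x y /pi_eq|c]; first by rewrite !reprK.
have [gamma gammaE] := con_of_surj (repr c).
exists (\pi_(H2 F S) gamma).
rewrite -[RHS]reprK -gammaE; apply/pi_eq; exact: reprK.
Qed.
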